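(* Let $s\ge2$ and $q=2^s$. There is a $(2^s+1)\,C^{s-1}Z\to 1\,C^{s-1}Z$ distillation protocol at distance $3$: let $G\in\mathbb F_q^{3\times(q+1)}$ have one column $(0,1,0)^{\mathsf T}$ and, for each $x\in\mathbb F_q$, one column $(x^2,x,1)^{\mathsf T}$; the first row is the single logical row and the other two rows are stabilizer rows. Then $G$ has full rank, and for all $a_1,\dots,a_s\in\{1,2,3\}$ $$\sum_{i=1}^{q+1}(g_{a_1,i})^{2^0}(g_{a_2,i})^{2^1}\cdots(g_{a_s,i})^{2^{s-1}}=\begin{cases}1&\text{if }a_1=\dots=a_s=1\\0&\text{otherwise;}\end{cases}$$ consequently applying the norm gate $N$ (equivalently $C^{s-1}Z$ up to Paulis) to each of the $2^s+1$ physical qudits acts on the code as the logical $N$; and the $Z$-distance of the code is $3$.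
   Context: An $\mathbb F_q$-qudit ($q=2^s$), with basis $|\gamma\rangle$, $\gamma\in\mathbb F_q$, is identified with $s$ qubits via an $\mathbb F_2$-basis of $\mathbb F_q$. The norm gate is $N|\gamma\rangle=(-1)^{\gamma^{q-1}}|\gamma\rangle$ (where $\gamma^{q-1}\in\{0,1\}$); up to global phase it equals $X^{\otimes s}\,C^{s-1}Z\,X^{\otimes s}$, where $C^{s-1}Z|b_1\cdots b_s\rangle=(-1)^{b_1\cdots b_s}|b_1\cdots b_s\rangle$. A full-rank matrix $G\in\mathbb F_q^{m\times n}$ with rows $\mathbf g_1,\dots,\mathbf g_m$ and $k$ logical rows defines a CSS code on $n$ qudits: the first $k$ rows are $X$-logical operators, the remaining rows generate the $X$-stabilizer space $\mathcal G_0$; logical basis states are $|\overline u\rangle\propto\sum_{\mathbf g\in\mathcal G_0}|\sum_{a\le k}u_a\mathbf g_a+\mathbf g\rangle$. ''Acts as the logical $N$'' (for $k=1$) means $N^{\otimes n}|\overline u\rangle=(-1)^{u^{q-1}}|\overline u\rangle$ for all $u\in\mathbb F_q$. The $Z$-distance is the minimum Hamming weight over $\mathbb F_q$ of a vector orthogonal (for $\sum x_iy_i$) to all stabilizer rows but not to at least one logical row. *)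

(* Defs.v *)
From HB Require Import structures.
From mathcomp Require Import all_boot all_order all_algebra all_field.
From mathcomp Require Import complex reals.

Set Implicit Arguments.
Unset Strict Implicit.
Unset Printing Implicit Defensive.

Import GRing.Theory Num.Theory.
Local Open Scope ring_scope.

Section States.
Variable C : numClosedFieldType.

(* Pure states (not necessarily normalized) of a register whose computational
   basis is labelled by T, as families of amplitudes; an operator is given by
   its matrix elements, A y x standing for <y|A|x>. *)
Definition state (T : finType) := {ffun T -> C^o}.
Definition operator (T : finType) := T -> T -> C.

Definition ket (T : finType) (x : T) : state T := [ffun y => (y == x)%:R].

Definition opapp (T : finType) (A : operator T) (psi : state T) : state T :=
  [ffun y => \sum_x A y x * psi x].

Definition opcomp (T : finType) (A B : operator T) : operator T :=
  fun y x => \sum_z A y z * B z x.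

Definition tensor_power (T : finType) (n : nat) (A : operator T) :
    operator 'rV[T]_n :=
  fun y x => \prod_(i < n) A (y 0 i) (x 0 i).
Arguments tensor_power {T} n A y x.

(* L acts on the labels of the logical basis states lgc, P on the physical
   register: P |x>_L = sum_y <y|L|x> |y>_L. *)
Definition implements (T U : finType) (lgc : U -> state T)
    (P : operator T) (L : operator U) : Prop :=
  forall x : U, opapp P (lgc x) = \sum_y L y x *: lgc y.

Definition phase_eq (T : finType) (A B : operator T) : Prop :=
  exists2 c : C, `|c| = 1 & forall y x, A y x = c * B y x.

Definition gateX : operator bool := fun y x => (y == ~~ x)%:R.

Definition gateCZ (s : nat) : operator 'rV[bool]_s :=
  fun y x => (-1) ^+ (\prod_(i < s) nat_of_bool (x 0%R i))%N * (y == x)%:R.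
Arguments gateCZ s y x : clear implicits.

(* C^{s-1}Z conjugated by the Pauli operator X on every qubit. *)
Definition gateXCZX (s : nat) : operator 'rV[bool]_s :=
  opcomp (tensor_power s gateX) (opcomp (gateCZ s) (tensor_power s gateX)).
Arguments gateXCZX s y x : clear implicits.

Section Codes.
Variable F : finFieldType.

(* x ^+ (q - 1) is 0 or 1 in F; the boolean reads it off as an integer. *)
Definition norm_sign (x : F) : C := (-1) ^+ (x ^+ #|F|.-1 == 1).

Definition gateN : operator F := fun y x => norm_sign x * (y == x)%:R.

(* G : 'M_(k + r, n): the upper k rows are logical, the lower r rows span the
   X-stabilizer space. The state is left unnormalized. *)
Definition codeword (k r n : nat) (G : 'M[F]_(k + r, n)) (u : 'rV[F]_k) :
    state 'rV[F]_n :=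
  \sum_(g : 'rV[F]_n | (g <= dsubmx G)%MS) ket (u *m usubmx G + g).

Definition acts_as_logical_N (r n : nat) (G : 'M[F]_(1 + r, n)) : Prop :=
  forall u : F,
    opapp (tensor_power n gateN) (codeword G u%:M) =
      norm_sign u *: codeword G u%:M.

Definition hamming_weight (n : nat) (x : 'rV[F]_n) : nat :=
  #|[set i | x 0 i != 0]|.

Definition Zlogical (k r n : nat) (G : 'M[F]_(k + r, n)) (x : 'rV[F]_n) : bool :=
  [forall b, \sum_i x 0 i * dsubmx G b i == 0] &&
  [exists a, \sum_i x 0 i * usubmx G a i != 0].

Definition has_Zdistance (k r n : nat) (G : 'M[F]_(k + r, n)) (d : nat) : Prop :=
  (exists2 x, Zlogical G x & hamming_weight x = d) /\
  (forall x, Zlogical G x -> (d <= hamming_weight x)%N).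

(* None labels the extra column (0,1,0)^T. *)
Definition code_col (c : option F) : 'cV[F]_3 :=
  \col_i nth 0 (if c is Some x then [:: x ^+ 2; x; 1] else [:: 0; 1; 0]) i.

(* The columns may come in any order. *)
Definition is_code_matrix (n : nat) (G : 'M[F]_(1 + 2, n)) : Prop :=
  exists2 sigma : 'I_n -> option F,
    bijective sigma & forall j, col j G = code_col (sigma j).

Variable ch2 : 2%N \in [pchar F].

(* Identification of s qubits with one qudit through an F_2-basis e of F
   (pPrimeCharType ch2 is F as a vector space over 'F_2). *)
Definition qudit_of_bits (s : nat) (e : s.-tuple (pPrimeCharType ch2))
    (b : 'rV[bool]_s) : F :=
  \sum_(i < s) (b 0 i)%:R *: e`_i.

Definition to_qubits (s : nat) (e : s.-tuple (pPrimeCharType ch2)) (n : nat)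
    (psi : state 'rV[F]_n) : state 'rV['rV[bool]_s]_n :=
  [ffun b => psi (map_mx (qudit_of_bits e) b)].

Definition gate_to_qubits (s : nat) (e : s.-tuple (pPrimeCharType ch2))
    (A : operator F) : operator 'rV[bool]_s :=
  fun y x => A (qudit_of_bits e y) (qudit_of_bits e x).

(* An n C^{s-1}Z -> 1 C^{s-1}Z protocol at distance d: one C^{s-1}Z on each of
   the n blocks of s qubits, conjugated by Pauli operators, performs the same
   gate on the s logical qubits of the code, up to a global phase. *)
Definition CZ_distillation (s : nat) (e : s.-tuple (pPrimeCharType ch2))
    (r n : nat) (G : 'M[F]_(1 + r, n)) (d : nat) : Prop :=
  [/\ row_free G,
      exists2 L : operator 'rV[bool]_s, phase_eq L (gateXCZX s) &
        implements
          (fun b => to_qubits e (codeword G (qudit_of_bits e b)%:M))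
          (tensor_power n (gateXCZX s)) L
    & has_Zdistance G d].

End Codes.
End States.

Arguments gateN C F y x : clear implicits.
Arguments gateXCZX C s y x : clear implicits.

(* Main.v *)
Require Import Defs.
From HB Require Import structures.
From mathcomp Require Import all_boot all_order all_algebra all_field.
From mathcomp Require Import complex reals.
From mathcomp Require cyclic.
From mathcomp Require Import zify.

Import GRing.Theory Num.Theory.
Local Open Scope ring_scope.
Local Open Scope complex_scope.

Set Implicit Arguments.
Unset Strict Implicit.
Unset Printing Implicit Defensive.

(* Number the rows from 0, so that row a has entry x^(2-a) in column x, and put
   q = 2^s. On the columns indexed by F the sum over i is a power sum
   sum_x x^E with E = sum_j (2 - a_j) 2^j in [0, 2(q-1)], hence 1 if E is q-1 or
   2(q-1) and 0 otherwise. Since the digits 2 - a_j are at most 2, E = q-1 only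
   when all of them are 1, and E = 2(q-1) only when all of them are 2; the extra
   column contributes exactly in the first case, where it cancels the power sum.

   Because y^(q-1) = prod_j y^(2^j) and Frobenius is additive, expanding the
   product gives sum_i (v G)_i^(q-1) = v_0^(q-1). So the parity of the number of
   nonzero coordinates is constant on the support of each logical basis state,
   which makes the transversal norm gate act by a sign.

   Any two columns of the stabilizer rows are independent, so the Z-distance is
   at least 3; the all-one vector on the extra column and the columns of 0 and 1
   attains it. On s qubits N is minus the conjugated C^{s-1}Z, and the number
   q+1 of blocks is odd, so the two global signs cancel. *)

(** * Power sums over a finite field *)

Lemma finField_card_pred_gt0 (F : finFieldType) : (0 < #|F|.-1)%N.
Proof. by have := finNzRing_gt1 F; case: #|F| => [|[]]. Qed.

Lemma finField_expf_card_pred (F : finFieldType) (x : F) :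
  x ^+ #|F|.-1 = (x != 0)%:R.
Proof.
have [->|x_neq0] := eqVneq x 0.
  by rewrite expr0n eqn0Ngt finField_card_pred_gt0.
apply: (mulfI x_neq0); rewrite -exprS mulr1 prednK ?expf_card //.
by rewrite ltnW // finNzRing_gt1.
Qed.

Lemma finField_card_eq0 (F : finFieldType) : #|F|%:R = 0 :> F.
Proof.
by rewrite -cardsT -FinRing.zmodXgE (cyclic.expg_cardG (G := fingroup.setT_group _)) ?inE.
Qed.

(** Otherwise all q-1 nonzero elements would be roots of X^r - 1, where r = n mod (q-1) satisfies 0
    < r < q-1. *)
Lemma finField_exists_expf_neq1 (F : finFieldType) (n : nat) :
  ~~ (#|F|.-1 %| n)%N -> exists2 x : F, x != 0 & x ^+ n != 1.
Proof.
move=> ndvd.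
have [/exists_inP//|] := boolP [exists (x : F | x != 0), x ^+ n != 1].
rewrite negb_exists_in => /forall_inP xn1.
set r := (n %% #|F|.-1)%N.
have r_gt0 : (0 < r)%N by rewrite lt0n.
have : (size (enum (predC1 (0%R : F))) <= r)%N.
  apply: max_unity_roots; rewrite ?enum_uniq //.
  apply/allP=> x; rewrite mem_enum inE /= => x_neq0.
  have := xn1 x x_neq0; rewrite negbK unity_rootE {1}(divn_eq n #|F|.-1).
  by rewrite exprD mulnC exprM finField_expf_card_pred x_neq0 expr1n mul1r.
by rewrite -cardE cardC1 leqNgt ltn_pmod ?finField_card_pred_gt0.
Qed.

Lemma finField_sum_exp (F : finFieldType) (n : nat) :
  \sum_(x : F) x ^+ n = if (0 < n)%N && (#|F|.-1 %| n)%N then -1 else 0.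
Proof.
(* With the convention 0^0 = 1, the exponent 0 gives q = 0 rather than q-1 = -1. *)
have [->|n_gt0] := posnP n.
  under eq_bigr do rewrite expr0.
  by rewrite sumr_const finField_card_eq0.
case: ifPn => /= [/dvdnP[k nE]|/finField_exists_expf_neq1[y y_neq0 yn_neq1]].
  have k_gt0 : (0 < k)%N by move: n_gt0; rewrite nE muln_gt0 => /andP[].
  rewrite (bigD1 0) //= expr0n gtn_eqF // add0r.
  rewrite (eq_bigr (fun=> 1)) => [|x x_neq0]; last first.
    by rewrite nE mulnC exprM finField_expf_card_pred x_neq0 expr1n.
  rewrite sumr_const cardC1.
  have /eqP := finField_card_eq0 F.
  by rewrite -[#|F|]prednK ?(ltnW (finNzRing_gt1 F)) // -natr1 addr_eq0 => /eqP.
(* Scaling by y permutes F and multiplies the sum by y^n != 1, so the sum vanishes. *)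
have mulyI : injective (fun x => y * x) by exact: mulfI.
apply/eqP; have : (y ^+ n - 1) * \sum_(x : F) x ^+ n == 0.
  rewrite mulrBl mul1r mulr_sumr [X in _ - X](reindex_inj mulyI) /=.
  by under [X in _ - X]eq_bigr do rewrite exprMn; rewrite subrr.
by rewrite mulf_eq0 subr_eq0 (negPf yn_neq1).
Qed.

(** * Base 2 expansions with digits at most 2 *)

Lemma sum_pow2 (s : nat) : (\sum_(j < s) 2 ^ j)%N = (2 ^ s).-1.
Proof. by rewrite predn_exp mul1n. Qed.

(** As 2^(s+1) - 1 is odd, the lowest digit is odd, hence 1; removing it and halving leaves 2^s -
    1. *)
Lemma digits_le2_eq1 (s : nat) (e : 'I_s -> nat) :
  (forall j, e j <= 2)%N -> (\sum_(j < s) e j * 2 ^ j)%N = (2 ^ s).-1 ->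
  forall j, e j = 1%N.
Proof.
elim: s e => [e _ _ []//|s IHs e e_le2].
rewrite big_ord_recl expn0 muln1 /=.
under eq_bigr do rewrite /bump /= add1n expnS mulnCA.
rewrite -big_distrr /= => sumE.
have pow_gt0 : (0 < 2 ^ s)%N by rewrite expn_gt0.
have e0E : e ord0 = 1%N by move: (e_le2 ord0) sumE; rewrite expnS; lia.
move=> j; case: (unliftP ord0 j) => [i ->|-> //].
apply: (IHs (fun i => e (lift ord0 i))) => [k|]; first exact: e_le2.
set S := LHS; have : (e ord0 + 2 * S)%N = (2 ^ s.+1).-1 := sumE.
by rewrite e0E expnS; lia.
Qed.

(* The digit sum lies between 0 and 2 (2^s - 1), so only the multiples 1 and 2
   of 2^s - 1 can occur. *)
Lemma dvdn_digits_le2 (s : nat) (e : 'I_s -> nat) :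
  (0 < s)%N -> (forall j, e j <= 2)%N ->
  let E := (\sum_(j < s) e j * 2 ^ j)%N in
  (0 < E)%N && ((2 ^ s).-1 %| E)%N =
    [forall j, e j == 2] || [forall j, e j == 1].
Proof.
move=> s_gt0 e_le2 E; have pow_gt1 : (1 < 2 ^ s)%N by rewrite -[1%N](expn0 2) ltn_exp2l.
have E_const c : (forall j, e j = c) -> E = (c * (2 ^ s).-1)%N.
  by move=> ec; rewrite -sum_pow2 big_distrr; apply: eq_bigr => j _; rewrite ec.
apply/idP/orP=> [/andP[E_gt0 /dvdnP[k Ek]]|]; last first.
  by case=> /forallP ec; rewrite (E_const _ (fun j => eqP (ec j))) dvdn_mull // andbT; lia.
(* The complementary digits 2 - e_j bound E from above, and when E is maximal they must all
   vanish. *)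
have compl : (E + \sum_(j < s) (2 - e j) * 2 ^ j)%N = (2 * (2 ^ s).-1)%N.
  rewrite -big_split -sum_pow2 big_distrr /=.
  by apply: eq_bigr => j _; rewrite -mulnDl subnKC.
have [k1|k_neq1] := eqVneq k 1%N.
  right; apply/forallP=> j; apply/eqP; apply: digits_le2_eq1 => //.
  by rewrite -/E Ek k1 mul1n.
have k2 : k = 2%N by nia.
left; apply/forallP=> j; rewrite eqn_leq e_le2 /= -subn_eq0.
move: compl; rewrite Ek k2 -[RHS]addn0 => /addnI /eqP.
rewrite sum_nat_eq0 => /forallP/(_ j) /=.
by rewrite muln_eq0 expn_eq0 orbF.
Qed.

(** * Columns of the code matrix *)

Lemma code_colE (F : finFieldType) (c : option F) (i : 'I_3) :
  code_col c i 0 = if c is Some x then x ^+ (2 - i) else (i == 1)%:R.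
Proof. by case: c i => [x|] [[|[|[|]]] //= i_lt]; rewrite mxE. Qed.

Lemma sum_option (V : nmodType) (T : finType) (f : option T -> V) :
  \sum_c f c = f None + \sum_x f (Some x).
Proof.
rewrite (bigD1 None) //=; congr (_ + _).
rewrite (reindex_omap Some id) => [|[]] //=.
by apply: eq_bigl => x; rewrite eqxx.
Qed.

Lemma exists_code_matrix (F : finFieldType) (n : nat) :
  #|F|.+1 = n -> exists G : 'M[F]_(1 + 2, n), is_code_matrix G.
Proof.
rewrite -card_option => <-.
exists (\matrix_(i, j) code_col (enum_val j : option F) i 0), enum_val.
  exact: enum_val_bij.
by move=> j; apply/colP=> i; rewrite !mxE.
Qed.

Lemma prodn_bool (T : finType) (b : T -> bool) :
  (\prod_i nat_of_bool (b i))%N = [forall i, b i].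
Proof.
have [/forallP bT|/forallPn[i /negPf bF]] := boolP [forall i, b i]; last first.
  by rewrite (bigD1 i) //= bF.
by rewrite big1 // => i _; rewrite bT.
Qed.

Lemma prodr_bool (R : pzSemiRingType) (T : finType) (b : T -> bool) :
  \prod_i (b i)%:R = [forall i, b i]%:R :> R.
Proof. by rewrite -natr_prod prodn_bool. Qed.

(** * Rank, power-sum identity and distance of the code matrix *)

Section CodeMatrix.
Variables (F : finFieldType) (n : nat) (G : 'M[F]_(1 + 2, n)).
Variables (sigma : 'I_n -> option F) (tau : option F -> 'I_n).
Hypotheses (sigmaK : cancel sigma tau) (tauK : cancel tau sigma).
Hypothesis colG : forall j, col j G = code_col (sigma j).

Lemma code_matrixE i j : G i j = code_col (sigma j) i 0.
Proof. by rewrite -colG mxE. Qed.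

Lemma code_matrix_tau i c :
  G i (tau c) = if c is Some x then x ^+ (2 - i) else (i == 1 :> nat)%:R.
Proof. by rewrite code_matrixE tauK code_colE. Qed.

Lemma sum_code_matrix (V : nmodType) (f : 'I_n -> V) :
  \sum_j f j = f (tau None) + \sum_(x : F) f (tau (Some x)).
Proof.
rewrite -(sum_option (fun c => f (tau c))).
by apply: reindex; exists sigma => ? _.
Qed.

Lemma code_matrix_row_free : row_free G.
Proof.
rewrite -kermx_eq0 -submx0; apply/rV_subP=> v /sub_kermxP vG0.
have dot c : \sum_i v 0 i * G i (tau c) = 0.
  by have /rowP/(_ (tau c)) := vG0; rewrite !mxE.
(* The extra column and the column of 0 are unit vectors, killing v_1 and v_2; the column of 1 then
   kills v_0. *)
have := dot (Some 1); have := dot (Some 0); have := dot None.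
rewrite !big_ord_recl !big_ord0 !code_matrix_tau /= !expr1n !expr0 expr1 !expr0n.
rewrite !mulr1 !mulr0 !add0r !addr0 => v1 v2; rewrite v1 v2 !addr0 => v0.
rewrite submx0; apply/eqP/rowP=> i; rewrite mxE.
case: (unliftP ord0 i) => [{}i ->|-> //].
by case: (unliftP ord0 i) => [k ->|-> //]; rewrite (ord1 k).
Qed.

Lemma code_matrix_sum_prod (s : nat) (a : 'I_s -> 'I_(1 + 2)) :
  (0 < s)%N -> #|F| = (2 ^ s)%N ->
  \sum_i \prod_(j < s) (G (a j) i) ^+ (2 ^ j) =
    (if [forall j, a j == ord0] then 1 else 0).
Proof.
move=> s_gt0 cardF; have pchar2 := card_finPcharP cardF isT.
rewrite sum_code_matrix (eq_bigr (fun j : 'I_s => (a j == 1 :> nat)%:R)); last first.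
  move=> j _; rewrite code_matrix_tau -natrX; case: eqP => _; rewrite ?exp1n ?exp0n //.
  by rewrite expn_gt0.
rewrite [X in _ + X](eq_bigr (fun x => x ^+ (\sum_(j < s) (2 - a j) * 2 ^ j)%N)); last first.
  move=> x _; rewrite expr_sum; apply: eq_bigr => j _.
  by rewrite code_matrix_tau exprM.
rewrite finField_sum_exp cardF dvdn_digits_le2 //; last by move=> j; rewrite leq_subr.
rewrite prodr_bool oppr_pchar2 //.
have -> : [forall j, a j == 1 :> nat] = [forall j, 2 - a j == 1]%N.
  by apply: eq_forallb => j; case: (a j) => [[|[|[]]]].
have -> : [forall j, a j == ord0] = [forall j, 2 - a j == 2]%N.
  by apply: eq_forallb => j; case: (a j) => [[|[|[]]]].
have [/forallP a2|_] /= := boolP [forall j, 2 - a j == 2]%N.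
  (* Since s > 0, the digits cannot be all 1 and all 2 at once, so the extra column contributes 0
     here. *)
  case: forallP => [/(_ (Ordinal s_gt0))|_]; last by rewrite add0r.
  by rewrite (eqP (a2 _)).
by case: ifP => _; rewrite ?addr0 // addrr_pchar2.
Qed.

(** The columns are (x,1) and (1,0): the minor is x - y for two field elements, and 1 or -1 with the
    extra column. *)
Lemma code_matrix_minor_neq0 (j k : 'I_n) :
  j != k ->
  dsubmx G 0 j * dsubmx G 1 k - dsubmx G 1 j * dsubmx G 0 k != 0.
Proof.
rewrite -(inj_eq (can_inj sigmaK)) -[j]sigmaK -[k]sigmaK !mxE !code_matrix_tau !tauK.
case: (sigma j) (sigma k) => [x|] [y|] //= xy;
  rewrite ?expr1 ?mulr1 ?mul1r ?mulr0 ?mul0r ?subr0 ?sub0r ?oppr_eq0 ?oner_neq0 ?subr_eq0 //.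
Qed.

(* Eliminating x_k between the two orthogonality relations leaves a relation
   among the other coordinates in which x_j has a nonzero coefficient. *)
Lemma code_matrix_third_support (x : 'rV[F]_n) (j k : 'I_n) :
  (forall b, \sum_i x 0 i * dsubmx G b i = 0) ->
  x 0 j != 0 -> j != k -> exists l, [&& l != j, l != k & x 0 l != 0].
Proof.
move=> orth xj jk; apply/existsP; apply: contraNT xj => /existsPn supp.
have : \sum_i x 0 i * (dsubmx G 0 i * dsubmx G 1 k - dsubmx G 1 i * dsubmx G 0 k) = 0.
  under eq_bigr do rewrite mulrBr !mulrA.
  by rewrite big_split /= sumrN -!mulr_suml !orth !mul0r subr0.
have kj : k != j by rewrite eq_sym.
rewrite (bigD1 j) //= (bigD1 k) //= big1 ?addr0 => [|l /andP[lj lk]]; last first.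
  by have := supp l; rewrite lj lk /= negbK => /eqP->; rewrite mul0r.
rewrite [dsubmx G 1 k * _]mulrC subrr mulr0 addr0 => /eqP.
by rewrite mulf_eq0 (negPf (code_matrix_minor_neq0 jk)) orbF.
Qed.

Lemma code_matrix_Zdistance : 2%N \in [pchar F] -> has_Zdistance G 3.
Proof.
move=> pchar2; split.
  pose d c : 'rV[F]_n := delta_mx 0 (tau c).
  have sum_d c f : \sum_i d c 0 i * f i = f (tau c).
    rewrite (bigD1 (tau c)) //= mxE !eqxx mul1r big1 ?addr0 // => i /negPf ic.
    by rewrite mxE ic andbF mul0r.
  have sum_x f : \sum_i (d None + d (Some 0) + d (Some 1)) 0 i * f i =
      f (tau None) + f (tau (Some 0)) + f (tau (Some 1)).
    by under eq_bigr do rewrite 2!mxE !mulrDl; rewrite !big_split /= !sum_d.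
  exists (d None + d (Some 0) + d (Some 1)).
    (* On the three chosen columns the logical row reads 0, 0, 1, with sum 1; the stabilizer rows
       read 1, 0, 1 and 0, 1, 1, with sum 0 in characteristic 2. *)
    apply/andP; split; last first.
      apply/existsP; exists 0; rewrite sum_x !mxE !code_matrix_tau /=.
      by rewrite expr0n expr1n !add0r oner_neq0.
    apply/forallP=> b; rewrite sum_x !mxE !code_matrix_tau.
    by case: b => [[|[|[]]]] //= _; rewrite ?expr1 ?addr0 ?add0r addrr_pchar2.
  have tauE := inj_eq (can_inj tauK).
  rewrite /hamming_weight (_ : [set _ | _] = tau None |: (tau (Some 0) |: [set tau (Some 1)])).
    by rewrite !cardsU1 cards1 !inE !tauE /= (inj_eq Some_inj) eq_sym oner_neq0.
  apply/setP=> l; rewrite !inE !mxE !eqxx /= -[l]sigmaK !tauE.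
  case: (sigma l) => [x|] /=; last by rewrite !addr0 oner_neq0.
  rewrite !(inj_eq Some_inj); have [->|_] := eqVneq x 0.
    by rewrite [0 == 1]eq_sym (negPf (oner_neq0 F)) add0r addr0 oner_neq0.
  by have [_|_] := eqVneq x 1; rewrite !add0r ?oner_neq0 ?eqxx.
move=> x /andP[/forallP orth /existsP[a nonorth]].
have [j xj] : exists j, x 0 j != 0.
  apply/existsP; apply: contraNT nonorth => /existsPn x0.
  by rewrite big1 // => i _; have := x0 i; rewrite negbK => /eqP->; rewrite mul0r.
have {}orth b : \sum_i x 0 i * dsubmx G b i = 0 by apply/eqP.
(* An arbitrary [k] different from [j] yields a second support index [l]; using [l] in place of [k]
   then yields a third, [m]. *)
have [k jk] : exists k, j != k.
  case sj: (sigma j) => [y|]; [exists (tau None) | exists (tau (Some 0))];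
  by rewrite -(inj_eq (can_inj sigmaK)) sj tauK.
have [l /and3P[lj _ xl]] := code_matrix_third_support orth xj jk.
have [m /and3P[mj ml xm]] : exists m, [&& m != j, m != l & x 0 m != 0].
  by apply: code_matrix_third_support => //; rewrite eq_sym.
have <- : #|j |: (l |: [set m])| = 3%N.
  by rewrite !cardsU1 cards1 !inE negb_or ![_ == m]eq_sym [j == l]eq_sym mj ml lj.
by apply/subset_leq_card/subsetP=> i; rewrite !inE => /or3P[]/eqP->.
Qed.

Lemma code_matrix_sum_norm (s : nat) (v : 'rV[F]_(1 + 2)) :
  (0 < s)%N -> #|F| = (2 ^ s)%N ->
  \sum_i ((v *m G) 0 i) ^+ #|F|.-1 = (v 0 0) ^+ #|F|.-1.
Proof.
move=> s_gt0 cardF; have pchar2 := card_finPcharP cardF isT.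
have frob j : [pchar F].-nat (2 ^ j)%N by rewrite pnatX pnatE // pchar2.
have frob0 j : 0 ^+ (2 ^ j) = 0 :> F by rewrite expr0n expn_eq0.
rewrite cardF -sum_pow2.
(* A function [f] picks one row in each Frobenius factor; only the constant choice [ord0] survives
   summation over the columns. *)
transitivity (\sum_(f : {ffun 'I_s -> 'I_(1 + 2)})
    (\prod_(j < s) v 0 (f j) ^+ (2 ^ j)) *
    \sum_i \prod_(j < s) G (f j) i ^+ (2 ^ j)).
  under [RHS]eq_bigr do rewrite mulr_sumr.
  rewrite [RHS]exchange_big /=; apply: eq_bigr => i _.
  under [RHS]eq_bigr do rewrite -big_split /=.
  rewrite -(bigA_distr_bigA (fun (j : 'I_s) a => v 0 a ^+ (2 ^ j) * G a i ^+ (2 ^ j))).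
  rewrite expr_sum; apply: eq_bigr => j _; rewrite mxE.
  rewrite (big_morph _ (fun x y => exprDn_pchar x y (frob j)) (frob0 j)).
  by under eq_bigr do rewrite exprMn.
rewrite (bigD1 [ffun=> ord0]) //= code_matrix_sum_prod // [X in _ + X]big1 => [|f f_neq].
  rewrite ifT; last by apply/forallP=> j; rewrite ffunE.
  by rewrite mulr1 addr0 expr_sum; apply: eq_bigr => j _; rewrite ffunE.
rewrite code_matrix_sum_prod // ifF ?mulr0 //.
apply: contraNF f_neq => /forallP f0; apply/eqP/ffunP=> j.
by rewrite ffunE; apply/eqP.
Qed.
End CodeMatrix.

(** * Diagonal operators and gate signs *)

Lemma natr_pchar2 (R : nzRingType) (m : nat) :
  2%N \in [pchar R] -> m%:R = (odd m)%:R :> R.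
Proof.
by move=> pchar2; rewrite -{1}(odd_double_half m) natrD -addnn natrD addrr_pchar2 ?addr0.
Qed.

Section Diagonal.
Variables (C : numClosedFieldType) (T : finType).

Lemma opapp_diag (A : operator C T) (d : T -> C) (psi : state C T) :
  (forall y x, A y x = d x * (y == x)%:R) ->
  forall y, opapp A psi y = d y * psi y.
Proof.
move=> AE y; rewrite ffunE (bigD1 y) //= AE eqxx mulr1 big1 ?addr0 // => x.
by rewrite eq_sym AE => /negPf->; rewrite mulr0 mul0r.
Qed.

Lemma rV_eqE (n : nat) (x y : 'rV[T]_n) : (x == y) = [forall i, x 0 i == y 0 i].
Proof.
apply/eqP/forallP=> [-> //|xy]; apply/rowP=> i.
by apply/eqP.
Qed.

Lemma tensor_power_diag (A : operator C T) (d : T -> C) (n : nat) :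
  (forall y x, A y x = d x * (y == x)%:R) ->
  forall y x : 'rV[T]_n, tensor_power A y x = (\prod_i d (x 0 i)) * (y == x)%:R.
Proof.
move=> AE y x; rewrite /tensor_power rV_eqE -prodr_bool -big_split /=.
by apply: eq_bigr => i _; rewrite AE.
Qed.

End Diagonal.

Lemma norm_signE (C : numClosedFieldType) (F : finFieldType) (x : F) :
  norm_sign C x = (-1) ^+ (x != 0).
Proof.
rewrite /norm_sign finField_expf_card_pred.
by case: (x == 0); rewrite ?eqxx // eq_sym oner_eq0.
Qed.

(** Flipping every bit moves the sign of the controlled gate from the all-one string to the all-zero
    string. *)
Lemma gateXCZXE (C : numClosedFieldType) (s : nat) (y x : 'rV[bool]_s) :
  gateXCZX C s y x = (-1) ^+ (x == const_mx false) * (y == x)%:R.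
Proof.
have flipE (v w : 'rV[bool]_s) :
    tensor_power (@gateX C) v w = (v == map_mx negb w)%:R.
  by rewrite rV_eqE -prodr_bool; apply: eq_bigr => i _; rewrite mxE.
have flipK : involutive (map_mx negb : 'rV[bool]_s -> 'rV[bool]_s).
  by move=> v; apply/rowP=> i; rewrite !mxE negbK.
rewrite /gateXCZX /opcomp (bigD1 (map_mx negb y)) //= [X in _ + X]big1 => [|z zy]; last first.
  by rewrite flipE eq_sym (can2_eq flipK flipK) (negPf zy) mul0r.
rewrite (bigD1 (map_mx negb x)) //= [X in _ * (_ + X)]big1 => [|w wx]; last first.
  by rewrite flipE (negPf wx) mulr0.
rewrite !flipE flipK !eqxx mulr1 mul1r !addr0 /gateCZ (inj_eq (can_inj flipK)).
congr (_ ^+ _ * _).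
rewrite prodn_bool rV_eqE.
by congr nat_of_bool; apply: eq_forallb => i; rewrite !mxE eqbF_neg.
Qed.

(** * The transversal norm gate on the code *)

Section CodeAction.
Variables (C : numClosedFieldType) (s : nat) (F : finFieldType).
Hypotheses (s_gt0 : (0 < s)%N) (cardF : #|F| = (2 ^ s)%N).

(** Each (q-1)-th power is the indicator of a nonzero entry, so in characteristic 2 the hypothesis
    fixes the parity of the weight of [y], which determines the product of signs. *)
Lemma prod_norm_sign (n : nat) (y : 'rV[F]_n) (u : F) :
  \sum_i (y 0 i) ^+ #|F|.-1 = u ^+ #|F|.-1 ->
  \prod_i norm_sign C (y 0 i) = norm_sign C u.
Proof.
move=> sumE.
have {sumE} : (\sum_i (y 0%R i != 0%R))%:R = (u != 0)%:R :> F.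
  rewrite -finField_expf_card_pred -sumE natr_sum.
  by apply: eq_bigr => i _; rewrite finField_expf_card_pred.
rewrite natr_pchar2 ?(card_finPcharP cardF) // => oddE.
under eq_bigr do rewrite norm_signE.
rewrite prodrXr norm_signE -[LHS]signr_odd; congr (_ ^+ nat_of_bool _).
by case: odd oddE; case: (u != 0) => // /eqP; rewrite ?oner_eq0 // eq_sym oner_eq0.
Qed.

Lemma code_matrix_acts_as_logical_N (n : nat) (G : 'M[F]_(1 + 2, n)) :
  is_code_matrix G -> acts_as_logical_N C G.
Proof.
move=> [sigma [tau sigmaK tauK] colG] u; apply/ffunP=> y.
rewrite (@opapp_diag _ _ _ (fun y : 'rV_n => \prod_i norm_sign C (y 0 i))); last first.
  by move=> *; apply: tensor_power_diag.
rewrite !ffunE /codeword !sum_ffunE mulr_sumr [RHS]mulr_sumr.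
apply: eq_bigr => g /submxP[v ->]; rewrite ffunE.
have [->|_] := eqVneq y; last by rewrite !mulr0.
congr (_ * _); apply: prod_norm_sign.
(* The basis label is the row vector (u, v) times [G], whose leading coefficient is u. *)
rewrite -mul_row_col vsubmxK.
rewrite (code_matrix_sum_norm sigmaK tauK colG _ s_gt0 cardF).
have -> : 0 = lshift 2 (0 : 'I_1) by exact: val_inj.
by rewrite row_mxEl mxE.
Qed.

End CodeAction.

(** * Passage from qudits to qubits *)

Section Qubits.
Variables (C : numClosedFieldType) (F : finFieldType) (ch2 : 2%N \in [pchar F]).
Variables (s : nat) (e : s.-tuple (pPrimeCharType ch2)).
Hypothesis e_free : free e.

Lemma qudit_of_bits_inj : injective (qudit_of_bits e).
Proof.
move=> x y /eqP; rewrite -subr_eq0 /qudit_of_bits -sumrB => /eqP xy.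
apply/rowP=> i; have /freeP/(_ (fun i => (x 0 i)%:R - (y 0 i)%:R)) := e_free.
under eq_bigr do rewrite scalerBl.
by move=> /(_ xy i); case: (x 0 i); case: (y 0 i).
Qed.

Lemma qudit_of_bits_eq0 (x : 'rV[bool]_s) :
  (qudit_of_bits e x == 0) = (x == const_mx false).
Proof.
rewrite -(inj_eq qudit_of_bits_inj); congr (_ == _).
by rewrite [RHS]big1 // => i _; rewrite mxE scale0r.
Qed.

(** The norm gate negates the nonzero labels, the conjugated gate only the zero label: hence the
    global phase -1, once per block. *)
Lemma norm_sign_qudit_of_bits (x : 'rV[bool]_s) :
  norm_sign C (qudit_of_bits e x) = - (-1) ^+ (x == const_mx false).
Proof. by rewrite norm_signE qudit_of_bits_eq0; case: eqP; rewrite // opprK. Qed.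

Lemma gate_to_qubits_gateN :
  phase_eq (gate_to_qubits e (gateN C F)) (gateXCZX C s).
Proof.
exists (-1) => [|y x]; first by rewrite normrN1.
rewrite gateXCZXE /gate_to_qubits /gateN norm_sign_qudit_of_bits.
by rewrite (inj_eq qudit_of_bits_inj) mulN1r mulNr.
Qed.

Lemma to_qubits_gateXCZX (n : nat) (psi : state C 'rV[F]_n) :
  opapp (tensor_power (gateXCZX C s)) (to_qubits e psi) =
  (-1) ^+ n *: to_qubits e (opapp (tensor_power (gateN C F)) psi).
Proof.
apply/ffunP=> b.
rewrite (@opapp_diag _ _ _ (fun b : 'rV_n => \prod_i (-1) ^+ (b 0 i == const_mx false))); last first.
  by move=> *; apply: (tensor_power_diag (d := fun b => (-1) ^+ (b == const_mx false))) => *; apply: gateXCZXE.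
rewrite ffunE [RHS]ffunE [in RHS]ffunE.
rewrite (@opapp_diag _ _ _ (fun y : 'rV_n => \prod_i norm_sign C (y 0 i))); last first.
  by move=> *; apply: tensor_power_diag.
rewrite [RHS]mulrA; congr (_ * _).
under [in RHS]eq_bigr do rewrite mxE norm_sign_qudit_of_bits.
by rewrite prodrN card_ord mulrA -exprMn mulrNN mulr1 expr1n mul1r.
Qed.

Lemma implements_gateXCZX (r n : nat) (G : 'M[F]_(1 + r, n)) :
  odd n -> acts_as_logical_N C G ->
  implements (fun b => to_qubits e (codeword C G (qudit_of_bits e b)%:M))
    (tensor_power (gateXCZX C s)) (gateXCZX C s).
Proof.
move=> n_odd actsG x; rewrite to_qubits_gateXCZX actsG -signr_odd n_odd.
rewrite (bigD1 x) //= big1 ?addr0 => [|y yx]; last first.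
  by rewrite gateXCZXE (negPf yx) mulr0 scale0r.
rewrite gateXCZXE eqxx mulr1; apply/ffunP=> b.
(* The -1 from the odd number of blocks cancels the -1 of the logical norm gate. *)
by rewrite !ffunE norm_sign_qudit_of_bits scalerA mulrNN mul1r.
Qed.

End Qubits.

Theorem mainTheorem7 (R : realType) (s : nat) (F : finFieldType)
    (hs : (2 <= s)%N) (hF : #|F| = (2 ^ s)%N) :
  (exists G : 'M[F]_(1 + 2, 2 ^ s + 1), is_code_matrix G) /\
  forall G : 'M[F]_(1 + 2, 2 ^ s + 1), is_code_matrix G ->
  [/\ row_free G,
      forall a : 'I_s -> 'I_(1 + 2),
        \sum_(i < 2 ^ s + 1) \prod_(j < s) (G (a j) i) ^+ (2 ^ j) =
          (if [forall j, a j == ord0] then 1 else 0),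
      acts_as_logical_N R[i] G,
      has_Zdistance G 3
    & forall e : s.-tuple (pPrimeCharType (card_finPcharP hF isT)),
        basis_of fullv e ->
        phase_eq (gate_to_qubits e (gateN R[i] F)) (gateXCZX R[i] s) /\
        CZ_distillation R[i] e G 3].
Proof.
have s_gt0 : (0 < s)%N by exact: ltnW.
split; first by apply: exists_code_matrix; rewrite hF addn1.
move=> G codeG; have actsG := code_matrix_acts_as_logical_N R[i] s_gt0 hF codeG.
have [sigma [tau sigmaK tauK] colG] := codeG.
have freeG := code_matrix_row_free tauK colG.
have distG := code_matrix_Zdistance sigmaK tauK colG (card_finPcharP hF isT).
split=> // [a|e /basis_free e_free].
  exact: (code_matrix_sum_prod sigmaK tauK colG a s_gt0 hF).
split; first exact: gate_to_qubits_gateN.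
split=> //; exists (gateXCZX R[i] s).
  by exists 1 => [|y x]; rewrite ?normr1 ?mul1r.
apply: implements_gateXCZX => //.
by rewrite oddD oddX eqn0Ngt s_gt0.
Qed.
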